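(* Let $r$ be a non-zero integer, $g$ a non-zero integer, and $E/\mathbb{Q}$ the elliptic curve $y^2=4x^3-\frac{40}{3}g^2x-\frac{224}{27}g^3$ (with CM by $\mathbb{Q}(\sqrt{-2})$). Then $\varpi_{E,r}=\varpi_{E,-r}$ if and only if $r\not\equiv2\ (\mathrm{mod}\ 4)$, in which case $\varpi_{E,r}=\varpi_{E,-r}=0$.
   Context: Write $g=(-1)^\delta2^\lambda g_1$ with $\delta\in\{0,1\}$, $\lambda\geqslant0$ an integer, $g_1\geqslant1$ odd. Put $\varpi_{E,r}=0$ if $r\not\equiv2$ mod $4$, and for $r\equiv2$ mod $4$ $$\varpi_{E,r}=\frac{h_{2,r}}{2}\Big(1+\frac12(-1)^{\frac{(r-2)(r+10)}{32}+\delta+\lambda+\frac{g_1-1}{2}}\Big(\frac2{g_1}\Big)\Omega_2(2;g_1,r)\Big),$$ where $\Omega_2(2;g_1,r)=\prod_{p^\nu\parallel g_1,\ p\nmid r,\ 2\nmid\nu}\frac{-1}{p-1-(\frac{-2}{p})}$ (empty product $=1$), $h_{2,r}=\sqrt2\prod_{p\nmid2r}\big(1-\frac{(\frac{-2}{p})}{p-1}\big)$ (product over primes in increasing order), and $(\frac\cdot\cdot)$ is the Legendre/Jacobi symbol. *)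

(* Defs.v *)
From HB Require Import structures.
From mathcomp Require Import all_boot all_order all_algebra.
From mathcomp Require Import ring.
From mathcomp Require Import all_classical all_reals all_analysis.

Set Implicit Arguments.
Unset Strict Implicit.
Unset Printing Implicit Defensive.

Import Order.TTheory GRing.Theory Num.Theory.
Import numFieldNormedType.Exports.

Local Open Scope classical_set_scope.
Local Open Scope ring_scope.

Definition legendre (a : int) (p : nat) : int :=
  if (p%:Z %| a)%Z then 0
  else if [exists x : 'I_p, (p%:Z %| (x%:Z) ^+ 2 - a)%Z] then 1
  else -1.

(* Used for odd n > 0 only; jacobi a 1 = 1. *)
Definition jacobi (a : int) (n : nat) : int :=
  \prod_(p <- primes n) legendre a p ^+ logn p n.

(* The elliptic curve y^2 = 4 x^3 - g2 x - g3 over Q. *)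
Record ellcurve := EllCurve {
  g2 : rat;
  g3 : rat;
  ellcurve_nonsingular : g2 ^+ 3 - 27%:R * g3 ^+ 2 != 0 }.

Definition on_curve (E : ellcurve) (x y : rat) : bool :=
  y ^+ 2 == 4%:R * x ^+ 3 - g2 E * x - g3 E.

Definition j_invariant (E : ellcurve) : rat :=
  12%:R ^+ 3 * g2 E ^+ 3 / (g2 E ^+ 3 - 27%:R * g3 E ^+ 2).

Definition cm_g2 (g : int) : rat := 40%:R / 3%:R * g%:~R ^+ 2.
Definition cm_g3 (g : int) : rat := 224%:R / 27%:R * g%:~R ^+ 3.

Lemma cm_discr (g : int) :
  cm_g2 g ^+ 3 - 27%:R * cm_g3 g ^+ 2 = 512%:R * g%:~R ^+ 6.
Proof.
have discr (F : numFieldType) (a : F) :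
    (40%:R / 3%:R * a ^+ 2) ^+ 3 - 27%:R * (224%:R / 27%:R * a ^+ 3) ^+ 2
    = 512%:R * a ^+ 6 by field.
exact: discr.
Qed.

Lemma cm_nonsingular (g : int) :
  g != 0 -> cm_g2 g ^+ 3 - 27%:R * cm_g3 g ^+ 2 != 0.
Proof.
move=> g0; rewrite cm_discr; apply: mulf_neq0; first by rewrite pnatr_eq0.
by apply: expf_neq0; rewrite intr_eq0.
Qed.

Definition cm_curve (g : int) (hg : g != 0) : ellcurve :=
  EllCurve (cm_nonsingular hg).

Lemma on_cm_curve (g : int) (hg : g != 0) (x y : rat) :
  on_curve (cm_curve hg) x y =
  (y ^+ 2 == 4%:R * x ^+ 3 - 40%:R / 3%:R * g%:~R ^+ 2 * x
             - 224%:R / 27%:R * g%:~R ^+ 3).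
Proof. by []. Qed.

(* 20^3 = 8000 is the j-invariant of the curves with CM by Z[sqrt(-2)]. *)
Lemma cm_curve_j (g : int) (hg : g != 0) :
  j_invariant (cm_curve hg) = 20%:R ^+ 3.
Proof.
have jE (F : numFieldType) (a : F) : a != 0 ->
    12%:R ^+ 3 * (40%:R / 3%:R * a ^+ 2) ^+ 3 / (512%:R * a ^+ 6)
    = 20%:R ^+ 3.
  move=> a0; have -> : 512%:R = 8%:R ^+ 3 :> F by rewrite -natrX.
  rewrite (exprM _ 2 3) -!exprMn -exprVn -exprMn; congr (_ ^+ 3).
  by field.
by rewrite /j_invariant /= cm_discr jE // intr_eq0.
Qed.

(* The parameter g of a curve E of the family, and 0 outside the family. *)
Definition twist (E : ellcurve) : int :=
  xget 0 [set g | exists hg : g != 0, E = cm_curve hg].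

Lemma twist_cm_curve (g : int) (hg : g != 0) : twist (cm_curve hg) = g.
Proof.
apply: xget_unique; first by exists hg.
move=> g' [hg' e].
have e2 : cm_g2 g = cm_g2 g' := congr1 g2 e.
have e3 : cm_g3 g = cm_g3 g' := congr1 g3 e.
have inj (F : numFieldType) (a b : F) : a != 0 ->
    40%:R / 3%:R * a ^+ 2 = 40%:R / 3%:R * b ^+ 2 ->
    224%:R / 27%:R * a ^+ 3 = 224%:R / 27%:R * b ^+ 3 -> a = b.
  move=> a0 /mulfI h2 /mulfI h3.
  have {}h2 : a ^+ 2 = b ^+ 2.
    by apply: h2; apply: mulf_neq0; rewrite ?invr_eq0 pnatr_eq0.
  have {}h3 : a ^+ 3 = b ^+ 3.
    by apply: h3; apply: mulf_neq0; rewrite ?invr_eq0 pnatr_eq0.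
  by move: h3; rewrite !(exprS _ 2) -h2; apply: mulIf; rewrite expf_neq0.
apply/esym/eqP; rewrite -(eqr_int rat); apply/eqP.
apply: (inj rat g%:~R g'%:~R _ e2 e3).
by rewrite intr_eq0.
Qed.

(* g = (-1)^delta * 2^lambda * g_1, for g != 0: see sign_2part_oddpartE. *)
Definition sign_exp (g : int) : nat := (g < 0)%R.
Definition two_exp (g : int) : nat := logn 2 `|g|%N.
Definition odd_part (g : int) : nat := (`|g| %/ 2 ^ two_exp g)%N.

Lemma sign_2part_oddpartE (g : int) : g != 0 ->
  g = (-1) ^+ sign_exp g * 2%:Z ^+ two_exp g * (odd_part g)%:Z
  /\ odd (odd_part g).
Proof.
move=> g0; have [m odd_m def_g] := pfactor_coprime (isT : prime 2)
  (etrans (absz_gt0 g) g0).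
have -> : odd_part g = m by rewrite /odd_part {1}def_g mulnK // expn_gt0.
split; last by rewrite -coprime2n.
rewrite {1}[g]intEsign -mulrA; congr (_ * _).
by rewrite [in LHS]def_g mulnC PoszM -[Posz (2 ^ _)]natz natrX natz.
Qed.

(* The primes are taken in increasing order: the product converges only
   conditionally. *)
Definition h2 (R : realType) (r : int) : R :=
  Num.sqrt 2%:R *
  limn (fun N : nat =>
    \prod_(0 <= p < N | prime p && ~~ (p%:Z %| 2 * r)%Z)
      (1 - (legendre (-2) p)%:~R / (p%:R - 1)) : R).

(* Omega_2(2; g1, r) *)
Definition Omega2_2 (R : realType) (g1 : nat) (r : int) : R :=
  \prod_(p <- primes g1 | ~~ (p%:Z %| r)%Z && odd (logn p g1))
    (-1 / (p%:R - 1 - (legendre (-2) p)%:~R)).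

(* The division by 32 is exact when r = 2 mod 4; the quotient can be
   negative, whence the integer power of -1. *)
Definition varpi (R : realType) (E : ellcurve) (r : int) : R :=
  let g := twist E in
  let delta := sign_exp g in
  let lambda := two_exp g in
  let g1 := odd_part g in
  if (r == 2 %[mod 4])%Z then
    h2 R r / 2%:R *
    (1 + 1 / 2%:R *
       (-1) ^ (((r - 2) * (r + 10) %/ 32)%Z
               + delta%:Z + lambda%:Z + ((g1 - 1) %/ 2)%N%:Z) *
       (jacobi 2 g1)%:~R * Omega2_2 R g1 r)
  else 0.

(* Main.v *)
(* If r = 2 mod 4, the exponents of -1 for r and -r differ by r / 2, which is
   odd, so varpi(r) - varpi(-r) is plus or minus h2 * Omega / 2.  Omega is a
   finite product of nonzero factors; the point is that the conditionally
   convergent product h2 converges to a nonzero limit, i.e. that the sum of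
   (-2/p) / p converges.

   This is Mertens's argument.  The symbol (-2/p) is a character chi modulo 8,
   so the partial sums of chi(n)/n and of chi(n) ln n / n are bounded.  Writing
   ln n as a sum over the prime powers dividing n and using Chebyshev's bound
   for the sum of ln p, the latter sum is L * (sum of chi(p) ln p / p) + O(1),
   where L, a partial sum of chi(n)/n, is at least 1/2.  So the sums of
   chi(p) ln p / p are bounded, and partial summation concludes. *)

Require Import Defs.
From mathcomp Require Import all_boot all_order all_algebra all_field.
From mathcomp Require Import ring lra zify.
From mathcomp Require Import all_classical all_reals all_analysis.
Set Implicit Arguments.
Unset Strict Implicit.
Unset Printing Implicit Defensive.
Import Order.TTheory GRing.Theory Num.Theory.
Import numFieldNormedType.Exports.
Local Open Scope ring_scope.

(** * The character modulo 8 attached to -2 *)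

(** The quadratic Dirichlet character of conductor 8 attached to Q(sqrt(-2)), tabulated by residue
    so that its properties reduce to finite case checks. *)
Definition chi (n : nat) : int :=
  nth 0 [:: 0; 1; 0; 1; 0; -1; 0; -1] (n %% 8).

Lemma chiM (m n : nat) : chi (m * n) = chi m * chi n.
Proof.
rewrite /chi -modnMm.
have: (m %% 8 < 8)%N by rewrite ltn_mod.
have: (n %% 8 < 8)%N by rewrite ltn_mod.
by move: (m %% 8)%N (n %% 8)%N => [|[|[|[|[|[|[|[|i]]]]]]]]
  [|[|[|[|[|[|[|[|j]]]]]]]].
Qed.

Lemma chiX (m k : nat) : chi (m ^ k) = chi m ^+ k.
Proof. by elim: k => // k IHk; rewrite expnS chiM IHk exprS. Qed.

Lemma chi_norm (n : nat) : `|chi n| <= 1.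
Proof.
rewrite /chi; have: (n %% 8 < 8)%N by rewrite ltn_mod.
by move: (n %% 8)%N => [|[|[|[|[|[|[|[|i]]]]]]]].
Qed.

Lemma chi_odd (n : nat) : odd n -> chi n = 1 \/ chi n = -1.
Proof.
have <- : odd (n %% 8) = odd n by rewrite odd_mod.
rewrite /chi; have: (n %% 8 < 8)%N by rewrite ltn_mod.
by move: (n %% 8)%N => [|[|[|[|[|[|[|[|i]]]]]]]] //; [left|left|right|right].
Qed.

(** A full period of [chi] sums to 0, so the partial sums are themselves periodic modulo 8. *)
Lemma chi_sum (n : nat) :
  \sum_(0 <= k < n) chi k = nth 0 [:: 0; 0; 1; 1; 2; 2; 1; 1] (n %% 8).
Proof.
elim: n => [|n IHn]; first by rewrite big_geq.
rewrite big_nat_recr //= IHn /chi -(addn1 n) -(modnDml n).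
have: (n %% 8 < 8)%N by rewrite ltn_mod.
by move: (n %% 8)%N => [|[|[|[|[|[|[|[|i]]]]]]]].
Qed.

Lemma chi_sum_norm (m n : nat) : `|\sum_(m <= k < n) chi k| <= 2.
Proof.
have [le_mn|/ltnW le_nm] := leqP m n; last by rewrite big_geq.
have -> : \sum_(m <= k < n) chi k
    = \sum_(0 <= k < n) chi k - \sum_(0 <= k < m) chi k.
  by rewrite [in RHS](big_cat_nat (leq0n m) le_mn) /= addrAC subrr add0r.
rewrite !chi_sum.
have: (m %% 8 < 8)%N by rewrite ltn_mod.
have: (n %% 8 < 8)%N by rewrite ltn_mod.
by move: (m %% 8)%N (n %% 8)%N => [|[|[|[|[|[|[|[|i]]]]]]]]
  [|[|[|[|[|[|[|[|j]]]]]]]].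
Qed.

(** With q = #|F|, the polynomial X^q - X is already the product of the X - x for x in F, so it
    acquires no further root in L. *)
Lemma Fp_frobenius_fixed (F : finFieldType) (L : fieldExtType F) (y : L) :
  y ^+ #|F| = y -> exists x : F, y = x%:A.
Proof.
move=> yF; have: root (map_poly (in_alg L) ('X^#|F| - 'X)) y.
  by rewrite rmorphB /= map_polyXn map_polyX rootE !hornerE yF subrr.
rewrite finField_genPoly rmorph_prod /=.
rewrite (eq_bigr (fun x : F => 'X - (x%:A)%:P)); last first.
  by move=> x _; rewrite rmorphB /= map_polyX map_polyC.
rewrite rootE horner_prod prodf_seq_eq0 => /hasP[x _].
by rewrite /= !hornerE subr_eq0 => /eqP; exists x.
Qed.

Lemma root_X4D1 (F : finFieldType) :
  exists (L : fieldExtType F) (z : L), z ^+ 4 = -1.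
Proof.
have sz : size ('X^4 + 1 : {poly F}) = 5%N.
  by rewrite size_polyDl size_polyXn // size_poly1.
have nz : 'X^4 + 1 != 0 :> {poly F} by rewrite -size_poly_eq0 sz.
have [L [zs defp _]] := FinSplittingFieldFor nz; exists L.
have: (size zs).+1 = 5%N.
  by rewrite -(size_prod_XsubC _ id) -(eqp_size defp) size_map_poly sz.
case: zs defp => // z zs defp _; exists z.
have: root (\prod_(z <- z :: zs) ('X - z%:P)) z.
  by rewrite root_prod_XsubC mem_head.
rewrite -(eqp_root defp) rmorphD /= map_polyXn rmorph1 rootE !hornerE.
by rewrite addr_eq0 => /eqP.
Qed.

(* The Gauss sum z + z^3, with z a primitive eighth root of unity, is a square
   root of -2 which the Frobenius map multiplies by chi p. *)
Lemma sqr_Fp_N2 (p : nat) : prime p -> odd p ->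
  (exists x : 'F_p, x ^+ 2 = - 2%:R) <-> chi p = 1.
Proof.
move=> p_pr p_odd; have [L [z z4]] := root_X4D1 'F_p.
have pcharL : p \in [pchar L] by rewrite pchar_lalg pchar_Fp.
have cardF : #|'F_p| = p by rewrite card_Fp.
pose t := z + z ^+ 3.
have t2 : t ^+ 2 = - 2%:R.
  have -> : t ^+ 2 = z ^+ 4 * (2 + z ^+ 2) + z ^+ 2 by rewrite /t; ring.
  by rewrite z4; ring.
have two_neq0 : 2%:R != 0 :> L.
  rewrite -(dvdn_pcharf pcharL) dvdn_prime2 //.
  by apply: contraTneq p_odd => ->.
have tp : t ^+ p = t *~ chi p.
  have -> : t ^+ p = z ^+ p + (z ^+ p) ^+ 3.
    rewrite -exprM mulnC exprM.
    exact: (rmorphD (pFrobenius_aut pcharL) z (z ^+ 3)).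
  have z8 : z ^+ 8 = 1 by rewrite (exprM z 4 2) z4 sqrrN expr1n.
  (* Since z^8 = 1, the Frobenius image of t depends only on p modulo 8; the four odd residues are
     then checked one by one. *)
  have zX m : z ^+ m = z ^+ (m %% 8).
    by rewrite {1}(divn_eq m 8) exprD mulnC exprM z8 expr1n mul1r.
  rewrite zX.
  have odd_r : odd (p %% 8) by rewrite odd_mod.
  rewrite /chi; have: (p %% 8 < 8)%N by rewrite ltn_mod.
  have z5 : z ^+ 5 = - z by rewrite exprSr z4 mulN1r.
  have z7 : z ^+ 7 = - z ^+ 3 by rewrite (exprD z 4 3) z4 mulN1r.
  have z9 : z ^+ 9 = z by rewrite exprS z8 mulr1.
  have z15 : (z ^+ 5) ^+ 3 = - z ^+ 3 by rewrite z5; ring.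
  have z21 : (z ^+ 7) ^+ 3 = - z.
    by rewrite z7 exprNn -exprM z9; ring.
  have z9' : (z ^+ 3) ^+ 3 = z by rewrite -exprM.
  case: (p %% 8)%N odd_r => [|[|[|[|[|[|[|[|i]]]]]]]] //= _ _; rewrite /t.
  - by rewrite z9' addrC.
  - by rewrite z15 z5 /= mulrN1z; ring.
  - by rewrite z21 z7 /= mulrN1z; ring.
have t_neq0 : t != 0.
  by have := two_neq0; rewrite -oppr_eq0 -t2 expf_eq0.
(* As t is nonzero and the characteristic is odd, t differs from -t, so the sign [chi p] can be read
   off t^p. *)
have tpE : (t ^+ p == t) = (chi p == 1).
  have tN : (- t == t) = false.
    rewrite eq_sym -subr_eq0 opprK -mulr2n -mulr_natr mulf_eq0.
    by rewrite (negPf t_neq0) (negPf two_neq0).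
  by rewrite tp; case: (chi_odd p_odd) => ->;
    rewrite ?mulr1z ?mulrN1z ?eqxx ?tN.
split=> [[x x2]|/eqP].
  apply/eqP; rewrite -tpE.
  have: (t - x%:A) * (t + x%:A) == 0.
    have -> : (t - x%:A) * (t + x%:A) = t ^+ 2 - (in_alg L x) ^+ 2.
      by rewrite subr_sqr.
    by rewrite -rmorphXn /= x2 t2 scaleNr scaler_nat subrr.
  have xp : (x%:A : L) ^+ p = x%:A.
    have xF : x ^+ p = x by have := expf_card x; rewrite cardF.
    by rewrite -[x%:A]/(in_alg L x) -rmorphXn /= xF.
  rewrite mulf_eq0 subr_eq0 addr_eq0 => /orP[/eqP->|/eqP->].
    by rewrite xp.
  by rewrite exprNn xp -signr_odd p_odd mulN1r.
rewrite -tpE => /eqP tF.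
have [|x tx] := @Fp_frobenius_fixed _ L t; first by rewrite cardF.
exists x.
apply: (fmorph_inj (in_alg L)).
by rewrite rmorphXn /= -tx t2 scaleNr scaler_nat.
Qed.

Lemma legendre_N2 (p : nat) : prime p -> odd p -> legendre (-2) p = chi p.
Proof.
move=> p_pr p_odd; have p_gt2 := odd_prime_gt2 p_odd p_pr.
have pndvd2 : (p%:Z %| -2)%Z = false by rewrite dvdzE /= gtnNdvd.
rewrite /legendre pndvd2.
have dvdE (x : nat) :
    (p%:Z %| x%:Z ^+ 2 - -2)%Z = ((x%:R : 'F_p) ^+ 2 == - 2%:R).
  have -> : x%:Z ^+ 2 - -2 = (x ^ 2 + 2)%N%:Z by lia.
  rewrite dvdzE /= (dvdn_pcharf (pchar_Fp p_pr)) natrD natrX.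
  by rewrite addr_eq0.
case: existsP => [[x]|no_x].
  rewrite dvdE => /eqP x2; apply/esym.
  by apply/(sqr_Fp_N2 p_pr p_odd); exists (x%:R).
case: (chi_odd p_odd) => // /(sqr_Fp_N2 p_pr p_odd)[x x2]; case: no_x.
have xp : (x < p)%N by rewrite (leq_trans (ltn_ord x)) // Fp_cast.
by exists (Ordinal xp); rewrite dvdE /= natr_Zp x2.
Qed.

(** * Summation by parts *)

Lemma abel_bound (R : realFieldType) (a b : nat -> R) (B : R) (m n : nat) :
  (forall k, (m <= k)%N -> 0 <= a k.+1 <= a k) ->
  (forall n, `|\sum_(m <= k < n) b k| <= B) ->
  `|\sum_(m <= k < n) a k * b k| <= a m * B.
Proof.
move=> a_mono b_bd.
have B_ge0 : 0 <= B by apply: le_trans (b_bd m).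
have am_ge0 : 0 <= a m by have /andP[h1 h2] := a_mono m (leqnn m); lra.
have [le_mn|/ltnW le_nm] := leqP m n; last first.
  by rewrite big_geq // normr0 mulr_ge0.
have an_ge0 : 0 <= a n.
  have /andP[h1 h2] := a_mono n le_mn; lra.
pose s j := \sum_(m <= k < j) b k.
(* Without the boundary term the sum is that of (a k - a k.+1) * s k.+1, whose nonnegative weights
   telescope to a m - a n. *)
have key : `|\sum_(m <= k < n) a k * b k - a n * s n| <= B * (a m - a n).
  elim: n le_mn {an_ge0} => [|n IHn].
    by rewrite leqn0 => /eqP->; rewrite /s !big_geq // mulr0 !subrr normr0 mulr0.
  rewrite leq_eqVlt => /orP[/eqP<-|].
    by rewrite /s !big_geq // mulr0 !subrr normr0 mulr0.
  rewrite ltnS => le_mn; have {}IHn := IHn le_mn.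
  have sS : s n.+1 = s n + b n by rewrite /s big_nat_recr.
  rewrite big_nat_recr //=.
  have -> : \sum_(m <= i < n) a i * b i + a n * b n - a n.+1 * s n.+1 =
     (\sum_(m <= i < n) a i * b i - a n * s n) + (a n - a n.+1) * s n.+1.
    by rewrite sS; ring.
  apply: le_trans (ler_normD _ _) _.
  have /andP[_ le_a] := a_mono n le_mn.
  have : `|(a n - a n.+1) * s n.+1| <= (a n - a n.+1) * B.
    by rewrite normrM ger0_norm ?subr_ge0 // ler_wpM2l ?subr_ge0 ?b_bd.
  lra.
have : `|a n * s n| <= a n * B.
  by rewrite normrM ger0_norm // ler_wpM2l ?b_bd.
have := ler_normD (\sum_(m <= k < n) a k * b k - a n * s n) (a n * s n).
rewrite subrK; lra.
Qed.

(** * Chebyshev's bound *)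

Lemma prod_primes_dvd (s : seq nat) (n : nat) :
  uniq s -> {in s, forall p, prime p /\ (p %| n)%N} ->
  (\prod_(p <- s) p %| n)%N.
Proof.
elim: s => [|p s IHs] /=; first by rewrite big_nil dvd1n.
move=> /andP[ps us] s_dvd; rewrite big_cons Gauss_dvd; last first.
  rewrite big_seq; apply: (big_rec (fun b => coprime p b)) => [|q b qs hb].
    exact: coprimen1.
  rewrite coprimeMr hb andbT.
  have [p_pr _] := s_dvd p (mem_head _ _).
  have [|q_pr _] := s_dvd q; first by rewrite inE qs orbT.
  by rewrite prime_coprime // dvdn_prime2 //; apply: contraNneq ps => ->.
have [_ ->] := s_dvd p (mem_head _ _).
by rewrite IHs // => q qs; apply: s_dvd; rewrite inE qs orbT.
Qed.

(** The two equal middle coefficients are both terms of the expansion of (1 + 1)^(2m+1). *)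
Lemma bin_central_le (m : nat) : ('C(m.*2.+1, m) <= 4 ^ m)%N.
Proof.
have e := expnDn 1 1 m.*2.+1.
have : ('C(m.*2.+1, m).*2 <= 2 ^ m.*2.+1)%N.
  rewrite e.
  have lt1 : (m < m.*2.+2)%N by lia.
  have lt2 : (m.+1 < m.*2.+2)%N by lia.
  rewrite (bigD1 (Ordinal lt1)) //= (bigD1 (Ordinal lt2)) //=; last first.
    by rewrite -val_eqE /= gtn_eqF.
  have -> : 'C(m.*2.+1, m.+1) = 'C(m.*2.+1, m).
    by rewrite -bin_sub; [congr 'C(_, _) |]; lia.
  rewrite !exp1n !muln1; lia.
by rewrite expnS mul2n leq_double -mul2n expnM.
Qed.

(** Erdos's induction: an even n > 2 adds no prime, and for n = 2m+1 the product is split after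
    m+1. *)
Lemma primorial_le (n : nat) : (\prod_(0 <= p < n.+1 | prime p) p <= 4 ^ n)%N.
Proof.
elim/ltn_ind: n => n IHn.
have [n_le2|n_gt2] := leqP n 2.
  by case: n n_le2 {IHn} => [|[|[|]]] //; rewrite unlock.
have [n_odd|n_even] := boolP (odd n); last first.
  rewrite big_mkcond big_nat_recr //= -big_mkcond /=.
  have -> : prime n = false.
    by apply: contraNF n_even => /even_prime[n2|//]; rewrite n2 in n_gt2.
  rewrite muln1; case: n n_gt2 IHn {n_even} => // n _ IHn.
  by rewrite (leq_trans (IHn n _)) // leq_exp2l.
pose m := n./2; have nE : n = m.*2.+1 by rewrite -[LHS]odd_double_half n_odd.
have m_gt0 : (0 < m)%N by lia.
have lt_mn : (m.+2 <= n.+1)%N by lia.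
rewrite (big_cat_nat _ lt_mn) //=.
have le1 : (\prod_(0 <= p < m.+2 | prime p) p <= 4 ^ m.+1)%N by apply: IHn; lia.
have le2 : (\prod_(m.+2 <= p < n.+1 | prime p) p <= 4 ^ m)%N.
  (* A prime p with m+1 < p <= 2m+1 divides (2m+1)! but neither m! nor (m+1)!, hence it divides the
     binomial coefficient. *)
  apply: leq_trans (bin_central_le m); apply: dvdn_leq.
    by rewrite bin_gt0; lia.
  rewrite -big_filter; apply: prod_primes_dvd.
    by rewrite filter_uniq // iota_uniq.
  move=> p; rewrite mem_filter mem_index_iota => /and3P[p_pr lt_mp lt_pn].
  split=> //; have := bin_fact (n := m.*2.+1) (m := m) ltac:(lia).
  have ndvd k : (k < p)%N -> (p %| k`!)%N = false.
    move=> lt_kp; apply/negP; elim: k lt_kp => [|k IHk] lt_kp.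
      by rewrite fact0 dvdn1 => /eqP p1; rewrite p1 in p_pr.
    rewrite factS Euclid_dvdM // => /orP[|/IHk]; last by apply; lia.
    by rewrite gtnNdvd.
  move=> e; have : (p %| (m.*2.+1)`!)%N by rewrite dvdn_fact //; lia.
  by rewrite -e !Euclid_dvdM // !ndvd ?orbF //; lia.
have -> : (4 ^ n = 4 ^ m.+1 * 4 ^ m)%N by rewrite -expnD; congr (_ ^ _)%N; lia.
exact: leq_mul.
Qed.

Lemma ln_prod (R : realType) (I : Type) (s : seq I) (P : pred I) (F : I -> R) :
  (forall i, P i -> 0 < F i) ->
  ln (\prod_(i <- s | P i) F i) = \sum_(i <- s | P i) ln (F i).
Proof.
move=> F_gt0.
have [//] : 0 < \prod_(i <- s | P i) F i /\
  ln (\prod_(i <- s | P i) F i) = \sum_(i <- s | P i) ln (F i).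
apply: (big_rec2 (fun x y => 0 < x /\ ln x = y)); first by rewrite ln1.
move=> i x y Pi [y_gt0 <-]; have Fi := F_gt0 i Pi.
by rewrite mulr_gt0 // lnM // posrE.
Qed.

Lemma ln_nat_ge0 (R : realType) (n : nat) : 0 <= ln n%:R :> R.
Proof.
case: n => [|n]; last by rewrite ln_ge0 // ler1n.
by rewrite ln0.
Qed.

Lemma theta_le (R : realType) (n : nat) :
  \sum_(0 <= p < n.+1 | prime p) ln p%:R <= n%:R * ln 4%:R :> R.
Proof.
rewrite -ln_prod => [|p p_pr]; last by rewrite ltr0n prime_gt0.
rewrite mulr_natl -lnXn ?ltr0n // -natr_prod -natrX.
rewrite ler_ln ?posrE ?ltr0n ?expn_gt0 //; first by rewrite ler_nat primorial_le.
by rewrite prodn_cond_gt0 // => p; apply: prime_gt0.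
Qed.

(** * Mertens's theorem for chi *)

Lemma chi_abel (R : realFieldType) (a : nat -> R) (m n : nat) :
  (forall k, (m <= k)%N -> 0 <= a k.+1 <= a k) ->
  `|\sum_(m <= k < n) a k * (chi k)%:~R| <= 2 * a m.
Proof.
move=> a_mono; rewrite mulrC; apply: abel_bound => // j.
by rewrite -rmorph_sum -intr_norm -[2]/(2%:~R) ler_int chi_sum_norm.
Qed.

(** Partial sums of the series for L(1, chi). *)
Definition Lsum (R : realType) (n : nat) : R :=
  \sum_(1 <= k < n.+1) (chi k)%:~R / k%:R.

Lemma Lsum_tail (R : realType) (m n : nat) : (m <= n)%N ->
  `|Lsum R n - Lsum R m| <= 2 / m.+1%:R.
Proof.
move=> le_mn; rewrite /Lsum (big_cat_nat (n := m.+1)) //= addrAC subrr add0r.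
under eq_bigr do rewrite mulrC.
apply: chi_abel => k lt_mk.
have k_gt0 : (0 < k)%N by apply: leq_ltn_trans lt_mk.
by rewrite invr_ge0 ler0n lef_pV2 ?posrE ?ltr0n // ler_nat leqnSn.
Qed.

Lemma Lsum0 (R : realType) : Lsum R 0 = 0.
Proof. by rewrite /Lsum big_geq. Qed.

Lemma Lsum_le2 (R : realType) (n : nat) : `|Lsum R n| <= 2.
Proof. by have := Lsum_tail R (leq0n n); rewrite Lsum0 subr0 divr1. Qed.

(** The sum up to 4 is 1 + 1/3, and the later terms change it by at most 2/5. This quantitative
    nonvanishing of L(1, chi) allows the division by [Lsum] later. *)
Lemma Lsum_ge (R : realType) (n : nat) : (0 < n)%N -> 2^-1 <= Lsum R n.
Proof.
have [n_lt4|n_ge4] := ltnP n 4.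
  case: n n_lt4 => [|[|[|[|]]]] // _ _;
  rewrite /Lsum /index_iota /= !big_cons big_nil /chi /=; lra.
move=> _; have : `|Lsum R n - Lsum R 4| <= 2 / 5%:R by apply: Lsum_tail.
have -> : Lsum R 4 = 4%:R / 3%:R.
  by rewrite /Lsum /index_iota /= !big_cons big_nil /chi /=; field.
by rewrite ler_norml => /andP[]; lra.
Qed.

(** Put k = d * q and use complete multiplicativity; in the induction n %/ d increases exactly when
    d divides the new index. *)
Lemma chi_dvd_sum (R : realType) (d n : nat) : (0 < d)%N ->
  \sum_(1 <= k < n.+1 | (d %| k)%N) (chi k)%:~R / k%:R
  = (chi d)%:~R / d%:R * Lsum R (n %/ d).
Proof.
move=> d_gt0; elim: n => [|n IHn].
  by rewrite div0n Lsum0 mulr0 big_geq.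
rewrite big_mkcond big_nat_recr //= -big_mkcond /= IHn divnS //.
case: ifP => [/dvdnP[q nE]|_]; last by rewrite add0n addr0.
have qE : (n %/ d).+1 = q.
  by rewrite -[LHS]add1n; have := divnS n d_gt0; rewrite nE dvdn_mull // mulnK.
have q_gt0 : (0 < q)%N by rewrite -qE.
rewrite add1n [in RHS]/Lsum big_nat_recr //= -/(Lsum R _) mulrDr qE nE.
rewrite chiM rmorphM natrM; congr (_ + _).
by field; rewrite !pnatr_eq0 -!lt0n q_gt0 d_gt0.
Qed.

Lemma logn_sum (p n N : nat) : prime p -> (0 < n <= N)%N ->
  logn p n = (\sum_(1 <= k < N.+1) (p ^ k %| n))%N.
Proof.
move=> p_pr /andP[n_gt0 le_nN].
have lt_l : (logn p n < N.+1)%N.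
  by rewrite ltnS (leq_trans _ le_nN) // ltnW // ltn_logl.
rewrite (big_cat_nat (n := (logn p n).+1)) //=.
rewrite [X in (_ + X)%N]big_nat_cond [X in (_ + X)%N]big1 ?addn0; last first.
  move=> k /andP[/andP[lt_k _] _].
  by rewrite pfactor_dvdn // leqNgt lt_k.
rewrite big_nat_cond (eq_bigr (fun=> 1%N)); last first.
  move=> k /andP[/andP[_ le_k] _].
  by rewrite pfactor_dvdn // -ltnS le_k.
by rewrite -big_nat_cond sum_nat_const_nat muln1 subSS subn0.
Qed.

(** This is the identity that ln n is the sum of the von Mangoldt function over the divisors of n.
    The ranges stop at N instead of n so that sums over n and over prime powers can be exchanged. *)
Lemma ln_nat_sum (R : realType) (n N : nat) : (0 < n <= N)%N ->
  ln n%:R = \sum_(0 <= p < N.+1 | prime p)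
              \sum_(1 <= k < N.+1) (p ^ k %| n)%:R * ln p%:R :> R.
Proof.
move=> n_bd; have /andP[n_gt0 le_nN] := n_bd.
have nE : n = (\prod_(0 <= p < N.+1 | prime p) p ^ logn p n)%N.
  rewrite -[LHS](partnT n_gt0) (widen_partn _ le_nN).
  rewrite big_mkcond [RHS]big_mkcond /=.
  apply: eq_bigr => p _; case: ifP => // p_npr.
  by rewrite lognE p_npr.
rewrite {1}nE natr_prod ln_prod => [|p p_pr]; last first.
  by rewrite ltr0n expn_gt0 prime_gt0.
apply: eq_bigr => p p_pr; rewrite natrX lnXn ?ltr0n ?prime_gt0 //.
by rewrite {1}(logn_sum p_pr n_bd) -[LHS]mulr_natl natr_sum mulr_suml.
Qed.

Lemma chi_ln_sum (R : realType) (N : nat) :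
  \sum_(1 <= n < N.+1) (chi n)%:~R / n%:R * ln n%:R =
  \sum_(0 <= p < N.+1 | prime p) \sum_(1 <= k < N.+1)
     (ln p%:R * ((chi p)%:~R / p%:R) ^+ k * Lsum R (N %/ p ^ k)) :> R.
Proof.
under eq_big_nat => n n_bd do rewrite (ln_nat_sum R n_bd) mulr_sumr.
rewrite exchange_big /=; apply: eq_bigr => p p_pr.
under eq_bigr do rewrite mulr_sumr.
rewrite exchange_big /=; apply: eq_bigr => k _.
rewrite expr_div_n -rmorphXn -natrX -chiX -mulrA -chi_dvd_sum; last first.
  by rewrite expn_gt0 prime_gt0.
rewrite mulr_sumr [RHS]big_mkcond /=; apply: eq_bigr => n _.
by case: (_ %| _)%N; rewrite ?mul1r ?mul0r ?mulr0 // mulrC.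
Qed.

Lemma ln_ge (R : realType) (x : R) : 0 < x -> 1 - x^-1 <= ln x.
Proof.
move=> x_gt0; have xV : 0 < x^-1 by rewrite invr_gt0.
have := @le_ln1Dx R (x^-1 - 1); rewrite [1 + _]addrC subrK lnV ?posrE //.
have gt1 : -1 < x^-1 - 1 by lra.
by move=> /(_ gt1); lra.
Qed.

Lemma ln_le (R : realType) (x : R) : 0 < x -> ln x <= x - 1.
Proof.
move=> x_gt0; have := @le_ln1Dx R (x - 1).
by rewrite [1 + _]addrC subrK; apply; lra.
Qed.

Lemma ln4_ge1 (R : realType) : 1 <= ln 4%:R :> R.
Proof.
have := @ln_ge R 2 ltac:(lra); have -> : 4%:R = 2 ^+ 2 :> R by rewrite -natrX.
by rewrite lnXn; lra.
Qed.

(** From ln (1 + 1/k) <= 1/k and 1 <= ln k one gets k * ln (k+1) <= k * ln k + 1 <= (k+1) * ln k.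
    Starting at 4 makes ln k >= 1 elementary, as ln 4 = 2 ln 2. *)
Lemma ln_div_decr (R : realType) (k : nat) : (4 <= k)%N ->
  0 <= (ln k.+1%:R / k.+1%:R : R) <= ln k%:R / k%:R.
Proof.
move=> k_ge4; have k_gt0 : (0 : R) < k%:R by rewrite ltr0n; lia.
have k1_gt0 : (0 : R) < k.+1%:R by rewrite ltr0n.
rewrite divr_ge0 ?ln_nat_ge0 ?ler0n //= ler_pdivrMr // mulrAC ler_pdivlMr //.
have k1E : k.+1%:R = k%:R + 1 :> R by rewrite -natr1.
have ln_k : 1 <= ln k%:R :> R.
  by apply: le_trans (ln4_ge1 R) _; rewrite ler_ln ?posrE ?ler_nat.
have : ln (k.+1%:R / k%:R) <= k.+1%:R / k%:R - 1 :> R.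
  by rewrite ln_le // divr_gt0.
rewrite ln_div ?posrE // -(ler_pM2r k_gt0) mulrBl mulrBl divfK ?gt_eqF //.
rewrite k1E; lra.
Qed.

Lemma chi_ln_bound (R : realType) (N : nat) :
  `|\sum_(1 <= n < N.+1) (chi n)%:~R / n%:R * ln n%:R| <= 2 * ln 4%:R :> R.
Proof.
have aux n : `|\sum_(4 <= k < n) (chi k)%:~R / k%:R * ln k%:R|
    <= 2 * (ln 4%:R / 4%:R) :> R.
  under eq_bigr do rewrite -mulrA mulrC (mulrC _^-1).
  by apply: chi_abel => k; apply: ln_div_decr.
have ln1_3 : 0 <= (ln 3%:R / 3%:R : R) <= ln 4%:R / 3%:R.
  rewrite divr_ge0 ?ln_nat_ge0 // ler_pM2r //.
  by rewrite ler_ln ?posrE ?ler_nat.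
have ln4 := ln4_ge1 R.
have [N_lt3|N_ge3] := ltnP N 3.
  have -> : \sum_(1 <= n < N.+1) (chi n)%:~R / n%:R * ln n%:R = 0 :> R.
    by case: N N_lt3 => [|[|[|]]] // _; rewrite /index_iota /= ?big_cons big_nil
      ?ln1 /chi /= ?mul0r ?mulr0 ?addr0.
  by rewrite normr0; lra.
rewrite (big_cat_nat (n := 4)) //=.
(* Before the range where ln n / n is known to decrease, only n = 3 contributes: ln 1 = 0 and
   [chi 2] = 0. *)
have -> : \sum_(1 <= n < 4) (chi n)%:~R / n%:R * ln n%:R = ln 3%:R / 3%:R :> R.
  rewrite /index_iota /= !big_cons big_nil ln1 /chi /=.
  by rewrite !(mul0r, mulr0, add0r, addr0, mul1r) mulrC.
apply: le_trans (ler_normD _ _) _; have := aux N.+1.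
by rewrite (ger0_norm (_ : 0 <= ln 3 / 3)); lra.
Qed.

(* ln n / (n (n - 1)) is at most the decrement of (ln n + 2) / n. *)
Lemma sum_ln_div_le (R : realType) (N : nat) :
  \sum_(2 <= n < N.+1) ln n%:R / (n%:R * (n%:R - 1)) <= 2 :> R.
Proof.
case: N => [|N]; first by rewrite big_geq.
suff le_tele : \sum_(2 <= n < N.+2) ln n%:R / (n%:R * (n%:R - 1)) <=
    2 - (ln N.+1%:R + 2) / N.+1%:R :> R.
  apply: le_trans le_tele _; rewrite gerBl divr_ge0 //.
  by rewrite addr_ge0 ?ln_nat_ge0.
elim: N => [|N IHN].
  by rewrite big_geq // ln1 add0r divr1 subrr.
rewrite big_nat_recr //=.
set x : R := N.+1%:R in IHN *; have xE : N.+2%:R = x + 1 :> R by rewrite -natr1.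
have x_gt0 : 0 < x by rewrite ltr0n.
rewrite xE addrK; have x_ge1 : 1 <= x by rewrite ler1n.
clearbody x.
have ln_x : ln (x + 1) - x^-1 <= ln x.
  have := @ln_le R ((x + 1) / x) ltac:(rewrite divr_gt0; lra).
  rewrite ln_div ?posrE //; last by lra.
  have -> : (x + 1) / x - 1 = x^-1 by field; lra.
  lra.
have -> : ln (x + 1) / ((x + 1) * x) = ln (x + 1) / x - ln (x + 1) / (x + 1).
  by field; rewrite !gt_eqF //; lra.
(* Once ln (x+1) / (x+1) cancels, the claim is (ln (x+1) - ln x) / x <= 2 * (1/x - 1/(x+1)); [h1]
   and [h2] compare both sides with 1/x^2. *)
have h1 : (ln (x + 1) - x^-1) / x <= ln x / x by rewrite ler_pM2r ?invr_gt0.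
have h2 : x^-1 * x^-1 <= 2 * (x^-1 - (x + 1)^-1).
  have -> : 2 * (x^-1 - (x + 1)^-1) = 2 / (x * (x + 1)).
    by field; rewrite !gt_eqF //; lra.
  rewrite ler_pdivlMr ?mulr_gt0 //; last lra.
  have -> : x^-1 * x^-1 * (x * (x + 1)) = 1 + x^-1 by field; lra.
  have : x^-1 <= 1 by rewrite invf_le1.
  lra.
move: IHN h1 h2; lra.
Qed.

Lemma geo_tail_le (R : realFieldType) (x : R) (K : nat) : 1 < x ->
  \sum_(2 <= k < K) x ^- k <= (x * (x - 1))^-1.
Proof.
move=> x_gt1; have x_gt0 : 0 < x by lra.
have [K_le2|K_gt2] := leqP K 2.
  by rewrite big_geq // invr_ge0 mulr_ge0; lra.
have -> : \sum_(2 <= k < K) x ^- k = (x - 1)^-1 * (x^-1 - x ^- K.-1).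
  case: K K_gt2 => // K; rewrite ltnS => K_gt1 /=.
  elim: K K_gt1 => // K IHK; rewrite ltnS leq_eqVlt => /orP[/eqP<-|K_gt1].
    by rewrite big_nat1; field; rewrite !gt_eqF //; lra.
  rewrite big_nat_recr //= ?IHK //; last lia.
  rewrite !exprS; field; rewrite ?expf_neq0 ?gt_eqF //; lra.
rewrite invfM mulrC ler_pM2r ?invr_gt0; last lra.
by rewrite gerBl invr_ge0 exprn_ge0 // ltW.
Qed.

Lemma chi_div_le (R : realType) (p : nat) :
  `|(chi p)%:~R / p%:R| <= p%:R^-1 :> R.
Proof.
rewrite normrM normfV normr_nat -intr_norm.
by rewrite ler_piMl ?invr_ge0 // -[1]/(1%:~R) ler_int chi_norm.
Qed.

(** The geometric sum over k >= 2 is at most 1 / (p * (p - 1)), and the sum over primes is enlarged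
    to all integers from 2 on. One factor 2 of the constant bounds [Lsum], the other is
    [sum_ln_div_le]. *)
Lemma higher_powers_le (R : realType) (N : nat) :
  `|\sum_(0 <= p < N.+1 | prime p) \sum_(2 <= k < N.+1)
     (ln p%:R * ((chi p)%:~R / p%:R) ^+ k * Lsum R (N %/ p ^ k))| <= 4%:R.
Proof.
have -> : 4%:R = 2 * 2 :> R by ring.
apply: le_trans (ler_wpM2r _ (sum_ln_div_le R N)) => //.
case: N => [|N].
  by rewrite big1 => [|p _]; rewrite ?normr0 big_geq ?mul0r.
apply: le_trans (ler_norm_sum _ _ _) _; rewrite mulr_suml.
rewrite (big_cat_nat (n := 2)) //= big_mkcond /=.
rewrite {1}/index_iota /= !big_cons big_nil /= !add0r.
rewrite big_mkcond /=; apply: ler_sum_nat => p /andP[p_gt1 _].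
have p_gt1R : 1 < p%:R :> R by rewrite ltr1n.
have ln_ge := ln_nat_ge0 R p.
case: ifP => [p_pr|_]; last by rewrite mulr_ge0 ?divr_ge0 ?mulr_ge0 //; lra.
apply: le_trans (ler_norm_sum _ _ _) _.
apply: le_trans (_ : \sum_(2 <= k < N.+2) (ln p%:R * 2) * p%:R ^- k <= _).
  apply: ler_sum => k _; rewrite !normrM normrX ger0_norm //.
  rewrite -!mulrA ler_wpM2l // mulrC ler_pM // ?Lsum_le2 //.
  by rewrite -exprVn lerXn2r ?nnegrE ?invr_ge0 // chi_div_le.
rewrite -mulr_sumr mulrAC ler_wpM2r // -[leRHS]mulrC mulrC.
by rewrite ler_wpM2l // geo_tail_le.
Qed.

(** The difference of the two values of [Lsum] is at most 2p/N, so each prime contributes at most 2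
    ln p / N, and Chebyshev's bound applies. *)
Lemma Lsum_error (R : realType) (N : nat) :
  `|\sum_(0 <= p < N.+1 | prime p) ln p%:R * ((chi p)%:~R / p%:R) *
     (Lsum R N - Lsum R (N %/ p))| <= 2 * ln 4%:R.
Proof.
case: N => [|N].
  rewrite big_mkcond /= big_nat1 normr0 mulr_ge0 //.
  by have := ln4_ge1 R; lra.
have N_gt0 : (0 : R) < N.+1%:R by rewrite ltr0n.
apply: le_trans (_ : 2 / N.+1%:R * (N.+1%:R * ln 4%:R) <= _); last first.
  by rewrite mulrA divfK ?gt_eqF.
apply: le_trans (ler_wpM2l _ (theta_le R N.+1)); last by rewrite divr_ge0.
apply: le_trans (ler_norm_sum _ _ _) _; rewrite mulr_sumr.
apply: ler_sum => p p_pr; rewrite !normrM ger0_norm ?ln_nat_ge0 //.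
rewrite -mulrA mulrC ler_wpM2r ?ln_nat_ge0 //.
have p_gt0 : (0 : R) < p%:R by rewrite ltr0n prime_gt0.
apply: le_trans (_ : p%:R^-1 * (2 / (N.+1 %/ p).+1%:R) <= _).
  by rewrite ler_pM // ?Lsum_tail ?leq_div // -normrM chi_div_le.
rewrite mulrCA ler_wpM2l // -invfM lef_pV2 ?posrE ?mulr_gt0 ?p_gt0 ?ltr0n //.
by rewrite -natrM ler_nat mulnC; apply/ltnW/ltn_ceil/prime_gt0.
Qed.

Lemma chi_ln_prime_bound (R : realType) : exists C : R, forall N,
  `|\sum_(0 <= p < N | prime p) ln p%:R * ((chi p)%:~R / p%:R)| <= C.
Proof.
exists (2 * (2 * ln 4%:R + 2 * ln 4%:R + 4%:R)) => N.
case: N => [|N].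
  by rewrite big_geq // normr0; have := ln4_ge1 R; lra.
case: N => [|N].
  by rewrite big_mkcond big_nat1 normr0; have := ln4_ge1 R; lra.
set A := \sum_(_ <= p < _ | _) _.
(* In [chi_ln_sum] the terms k = 1 are set apart, and there [Lsum] at N.+1 %/ p is replaced by
   [Lsum] at N.+1. The outer factor 2 of the bound comes from dividing by [Lsum], which is at least
   1/2. *)
have key : Lsum R N.+1 * A =
    \sum_(1 <= n < N.+2) (chi n)%:~R / n%:R * ln n%:R
    + \sum_(0 <= p < N.+2 | prime p) ln p%:R * ((chi p)%:~R / p%:R) *
        (Lsum R N.+1 - Lsum R (N.+1 %/ p))
    - \sum_(0 <= p < N.+2 | prime p) \sum_(2 <= k < N.+2)
     (ln p%:R * ((chi p)%:~R / p%:R) ^+ k * Lsum R (N.+1 %/ p ^ k)).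
  rewrite chi_ln_sum mulr_sumr -big_split -sumrB /=; apply: eq_bigr => p _.
  by rewrite big_ltn //= expr1 expn1; ring.
have hL : 2^-1 <= Lsum R N.+1 by apply: Lsum_ge.
have : `|Lsum R N.+1 * A| <= 2 * ln 4%:R + 2 * ln 4%:R + 4%:R.
  rewrite key; apply: le_trans (ler_normB _ _) _.
  apply: lerD (higher_powers_le R N.+1); apply: le_trans (ler_normD _ _) _.
  exact: lerD (chi_ln_bound R N.+1) (Lsum_error R N.+1).
rewrite normrM ger0_norm; last lra.
have : 2^-1 * `|A| <= Lsum R N.+1 * `|A| by rewrite ler_wpM2r.
lra.
Qed.

(* Partial summation from [chi_ln_prime_bound], with weights 1 / ln p. *)
Lemma chi_prime_tail (R : realType) : exists C : R, forall m n, (2 <= m)%N ->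
  `|\sum_(m <= p < n | prime p) (chi p)%:~R / p%:R| <= C / ln m%:R.
Proof.
have [C C_bd] := chi_ln_prime_bound R; exists (C + C) => m n m_ge2.
pose b p : R := if prime p then ln p%:R * ((chi p)%:~R / p%:R) else 0.
have ln_gt0' k : (m <= k)%N -> 0 < ln k%:R :> R.
  by move=> le_mk; rewrite ln_gt0 // ltr1n (leq_trans m_ge2).
have -> : \sum_(m <= p < n | prime p) (chi p)%:~R / p%:R
    = \sum_(m <= p < n) (ln p%:R)^-1 * b p.
  rewrite big_mkcond; apply: eq_big_nat => p /andP[le_mp _] /=.
  by rewrite /b; case: ifP => _; rewrite ?mulr0 // mulKf // gt_eqF // ln_gt0'.
rewrite mulrC; apply: abel_bound => [k le_mk|j].
  have k_gt0 : (0 < k)%N by rewrite (leq_trans _ le_mk) // ltnW.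
  rewrite invr_ge0 ln_nat_ge0 lef_pV2 ?posrE ?ln_gt0' ?(leqW le_mk) //.
  by rewrite ler_ln ?posrE ?ltr0n // ler_nat leqnSn.
have [le_mj|/ltnW le_jm] := leqP m j; last first.
  (* For an empty range one needs C >= 0, which is [C_bd] at the empty sum. *)
  rewrite big_geq // normr0; have := C_bd 0%N; have := normr_ge0 (0 : R).
  by rewrite big_geq // normr0; lra.
have -> : \sum_(m <= k < j) b k = \sum_(0 <= k < j) b k - \sum_(0 <= k < m) b k.
  by rewrite [in RHS](big_cat_nat (leq0n m) le_mj) /= addrAC subrr add0r.
rewrite -!big_mkcond; apply: le_trans (ler_normB _ _) _.
exact: lerD (C_bd j) (C_bd m).
Qed.

(** * Logarithm of one factor of h2 *)

Lemma ln1D_approx (R : realType) (y : R) : `|y| <= 2^-1 ->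
  `|ln (1 + y) - y| <= 2 * y ^+ 2.
Proof.
rewrite ler_norml => /andP[y_ge y_le].
have y1_gt0 : 0 < 1 + y by lra.
have up := @ln_le R (1 + y) y1_gt0.
have lo := @ln_ge R (1 + y) y1_gt0.
have sq_ge0 : 0 <= y ^+ 2 by rewrite sqr_ge0.
(* After multiplication by 1 + y this says y^2 * (1 + 2y) >= 0, hence the hypothesis on y. *)
have : y - 2 * y ^+ 2 <= 1 - (1 + y)^-1.
  have -> : 1 - (1 + y)^-1 = y / (1 + y) by field; lra.
  rewrite ler_pdivlMr //; nra.
rewrite ler_norml => ?; apply/andP; split; lra.
Qed.

Definition h2_factor (R : realType) (p : nat) : R :=
  1 - (chi p)%:~R / (p%:R - 1).

(** With u = 1/(p-1), the quadratic error is 2u^2 <= 3u/p because p >= 3, and replacing 1/(p-1) by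
    1/p costs u/p more. The total 4u/p is written as a difference that telescopes over p. *)
Lemma h2_factor_approx (R : realType) (p : nat) : (3 <= p)%N ->
  0 < h2_factor R p /\
  `|ln (h2_factor R p) + (chi p)%:~R / p%:R|
    <= 4%:R * ((p%:R - 1)^-1 - p%:R^-1).
Proof.
move=> p_ge3; have pR : 3%:R <= p%:R :> R by rewrite ler_nat.
rewrite /h2_factor; set x := p%:R in pR *; clearbody x.
have c_le : `|(chi p)%:~R : R| <= 1.
  by rewrite -intr_norm -[1]/(1%:~R) ler_int chi_norm.
set c := (chi p)%:~R in c_le *; clearbody c.
pose u := (x - 1)^-1.
have u_gt0 : 0 < u by rewrite invr_gt0; lra.
have u_le : u <= 2^-1 by rewrite lef_pV2 ?posrE; lra.
have cu_le : `|- (c * u)| <= u.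
  by rewrite normrN normrM (gtr0_norm u_gt0) ler_piMl // ltW.
have xE : x^-1 = u - u * x^-1 by rewrite /u; field; rewrite !gt_eqF //; lra.
have h1 := ln1D_approx (le_trans cu_le u_le).
have c2 : c ^+ 2 <= 1 by move: c_le; rewrite ler_norml => /andP[? ?]; nra.
have xV_gt0 : 0 < x^-1 by rewrite invr_gt0; lra.
have ux_gt0 : 0 < u * x^-1 by rewrite mulr_gt0.
have uxE : u - x^-1 = u * x^-1 by lra.
have u2 : u ^+ 2 <= 3%:R / 2 * (u * x^-1).
  have -> : u ^+ 2 = x / (x - 1) * (u * x^-1).
    by rewrite /u; field; rewrite !gt_eqF //; lra.
  rewrite ler_pM2r // ler_pdivrMr; lra.
split.
  by move: cu_le; rewrite ler_norml -/u => /andP[? ?]; lra.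
rewrite -/u uxE.
have -> : ln (1 - c * u) + c / x =
    (ln (1 + - (c * u)) - - (c * u)) - c * (u * x^-1) by rewrite -uxE; ring.
apply: le_trans (ler_normB _ _) _.
have h2 : `|c * (u * x^-1)| <= u * x^-1.
  by rewrite normrM (gtr0_norm ux_gt0) ler_piMl // ltW.
have h3 : (- (c * u)) ^+ 2 <= u ^+ 2.
  by rewrite sqrrN exprMn ler_piMl // sqr_ge0.
lra.
Qed.

(** * The product h2 *)

Lemma ln_h2_factor_tail (R : realType) : exists C : R, forall m n, (3 <= m)%N ->
  `|\sum_(m <= p < n | prime p) ln (h2_factor R p)|
    <= C / ln m%:R + 4%:R / (m%:R - 1).
Proof.
have [C C_bd] := chi_prime_tail R; exists C => m n m_ge3.
have m1_gt0 : (0 : R) < m%:R - 1 by rewrite subr_gt0 ltr1n ltnW.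
have tele : \sum_(m <= p < n) 4%:R * ((p%:R - 1)^-1 - p%:R^-1)
    <= 4%:R / (m%:R - 1) :> R.
  have [lt_nm|le_mn] := ltnP n m.
    by rewrite big_geq ?(ltnW lt_nm) // divr_ge0 // ltW.
  have -> : \sum_(m <= p < n) 4%:R * ((p%:R - 1)^-1 - p%:R^-1)
      = 4%:R * ((m%:R - 1)^-1 - (n%:R - 1)^-1) :> R.
    rewrite -mulr_sumr -[in RHS]opprB; congr (_ * _).
    rewrite -(telescope_sumr (fun p => (p%:R - 1)^-1 : R) le_mn) -sumrN.
    by apply: eq_bigr => p _; rewrite -natr1 addrK opprB.
  rewrite ler_wpM2l // gerBl invr_ge0 subr_ge0 ler1n.
  by rewrite (leq_trans _ le_mn) // (leq_trans _ m_ge3).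
have -> : \sum_(m <= p < n | prime p) ln (h2_factor R p) =
    \sum_(m <= p < n | prime p) (ln (h2_factor R p) + (chi p)%:~R / p%:R)
    - \sum_(m <= p < n | prime p) (chi p)%:~R / p%:R.
  by rewrite -sumrB; apply: eq_bigr => p _; rewrite addrK.
rewrite [leRHS]addrC; apply: le_trans (ler_normB _ _) _.
apply: lerD; last by apply: C_bd; apply: ltnW.
apply: le_trans (ler_norm_sum _ _ _) _; apply: le_trans tele.
rewrite big_mkcond; apply: ler_sum_nat => p /andP[le_mp _].
have p_ge3 := leq_trans m_ge3 le_mp.
case: ifP => _; first by have [] := h2_factor_approx R p_ge3.
rewrite mulr_ge0 // subr_ge0 lef_pV2 ?posrE ?gerBl //.
  by rewrite ltr0n (leq_trans _ p_ge3).
by rewrite subr_gt0 ltr1n ltnW.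
Qed.

Lemma h2_term (R : realType) (r : int) (p : nat) :
  prime p -> ~~ (p%:Z %| 2 * r)%Z ->
  0 < h2_factor R p /\
  1 - (legendre (-2) p)%:~R / (p%:R - 1) = h2_factor R p.
Proof.
move=> p_pr p_ndvd; have p_odd : odd p.
  by case/even_prime: p_pr p_ndvd => // ->; rewrite dvdz_mulr.
have p_ge3 := odd_prime_gt2 p_odd p_pr.
rewrite /h2_factor legendre_N2 //; split=> //.
by have [] := h2_factor_approx R p_ge3.
Qed.

(** The logarithms of the factors form a Cauchy series, so the products tend to the exponential of
    its sum, which is nonzero. *)
Lemma h2_neq0 (R : realType) (r : int) : r != 0 -> h2 R r != 0.
Proof.
move=> r_neq0; pose u p : R :=
  if prime p && ~~ (p%:Z %| 2 * r)%Z then ln (h2_factor R p) else 0.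
have u_cvg : cvgn (series u).
  apply/cauchy_cvgP/cauchy_seriesP => e e_gt0.
  have [C C_bd] := ln_h2_factor_tail R.
  pose D := `|C| + 1; have D_gt0 : 0 < D by rewrite ltr_wpDl.
  have C_le : C <= D by have := ler_norm C; rewrite /D; lra.
  (* Beyond |2r| no prime divides 2r, so the tail is the one of [ln_h2_factor_tail]; the other two
     bounds make each of its terms less than e/2. *)
  pose N := maxn (maxn 3 `|2 * r|.+1)
    (maxn (Num.bound (expR (2 * D / e))) (Num.bound (8%:R / e + 1))).
  (* The tail bound is uniform in the upper end, so only the lower end has to be large. *)
  exists ([set k | (N <= k)%N]%classic, setT) => /=.
    by split; [exists N | exact: filterT].
  move=> [m n] /= []; rewrite !geq_max.
  move=> /andP[/andP[m_ge3 m_gtr] /andP[m1 m2]] _.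
  have -> : \sum_(m <= k < n) u k
      = \sum_(m <= k < n | prime k) ln (h2_factor R k).
    rewrite [RHS]big_mkcond; apply: eq_big_nat => k /andP[le_mk _].
    rewrite /u dvdzE gtnNdvd ?andbT //; first by rewrite absz_gt0 mulf_neq0.
    exact: leq_trans m_gtr le_mk.
  apply: le_lt_trans (C_bd m n m_ge3) _.
  have m_gt1 : (1 : R) < m%:R by rewrite ltr1n ltnW.
  have ln_gt : 2 * D / e < ln m%:R.
    rewrite -ltr_expR lnK ?posrE; last by lra.
    apply: lt_le_trans (_ : (Num.bound (expR (2 * D / e)))%:R <= _).
      by rewrite archi_boundP // expR_ge0.
    by rewrite ler_nat.
  have m_gt : 8%:R / e + 1 < m%:R.
    apply: lt_le_trans (_ : (Num.bound (8%:R / e + 1))%:R <= _).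
      by rewrite archi_boundP // addr_ge0 // divr_ge0 // ltW.
    by rewrite ler_nat.
  have ln_gt0 : 0 < ln m%:R :> R by rewrite ln_gt0.
  have : C / ln m%:R < e / 2.
    rewrite ltr_pdivrMr //; move: ln_gt; rewrite ltr_pdivrMr //; lra.
  have : 4%:R / (m%:R - 1) < e / 2.
    rewrite ltr_pdivrMr; last by lra.
    have : 8%:R / e < m%:R - 1 by lra.
    rewrite ltr_pdivrMr //; lra.
  lra.
rewrite /h2; apply: mulf_neq0; first by rewrite sqrtr_eq0 -ltNge.
set P := (fun N : nat => _).
have -> : P = expR \o series u.
  apply: funext => N; rewrite /P /= /series /= expR_sum big_mkcond.
  apply: eq_bigr => p _; rewrite /u; case: ifP => [/andP[p_pr p_ndvd]|_].
    by have [fac_gt0 ->] := h2_term R p_pr p_ndvd; rewrite lnK.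
  by rewrite expR0.
(* [limn] is a genuine limit only once convergence is known. *)
have P_cvg : ((expR \o series u) @ \oo --> expR (limn (series u)))%classic.
  by apply: continuous_cvg => //; exact: continuous_expR.
by rewrite (cvg_lim _ P_cvg) // expR_eq0.
Qed.

(** * The finite factors, the sign, and the conclusion *)

Lemma jacobi2_neq0 (n : nat) : odd n -> jacobi 2 n != 0.
Proof.
move=> n_odd; rewrite /jacobi prodf_seq_neq0; apply/allP => p.
rewrite mem_primes => /and3P[p_pr _ p_dvd]; rewrite /= expf_neq0 // /legendre.
have p_odd : odd p := dvdn_odd p_dvd n_odd.
rewrite dvdzE /= gtnNdvd ?odd_prime_gt2 //.
by case: ifP.
Qed.

(** As p >= 3 and the symbol is at most 1, each denominator is at least 1. *)
Lemma Omega2_2_neq0 (R : realType) (n : nat) (r : int) :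
  odd n -> Omega2_2 R n r != 0.
Proof.
move=> n_odd; rewrite /Omega2_2 prodf_seq_neq0; apply/allP => p.
rewrite mem_primes => /and3P[p_pr _ p_dvd]; apply/implyP => _.
have p_odd : odd p := dvdn_odd p_dvd n_odd.
have p_ge3 : 3%:R <= p%:R :> R by rewrite ler_nat odd_prime_gt2.
have : (chi p)%:~R <= 1 :> R.
  rewrite -[1]/(1%:~R) ler_int; exact: le_trans (ler_norm _) (chi_norm p).
rewrite -legendre_N2 // => leg_le.
by rewrite mulf_neq0 ?oppr_eq0 ?oner_eq0 // invr_neq0 // gt_eqF //; lra.
Qed.

Lemma mod4_oppz (r : int) : (- r == 2 %[mod 4])%Z = (r == 2 %[mod 4])%Z.
Proof. by apply/eqP/eqP; lia. Qed.

(** For r = 4k + 2 the quotient is k(k+3)/2, and passing to -r replaces k by -k-1, which gives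
    (k+1)(k-2)/2; the difference is 2k + 1. *)
Lemma exponent_oppz (r : int) : (r = 2 %[mod 4])%Z ->
  exists k, ((r - 2) * (r + 10) %/ 32)%Z =
    ((- r - 2) * (- r + 10) %/ 32)%Z + (2 * k + 1).
Proof.
move=> r_mod4; pose k := ((r - 2) %/ 4)%Z; exists k.
have rE : r = 4 * k + 2 by rewrite /k; lia.
have [j jE] : exists j, k * (k + 3) = 2 * j.
  have [l [|]] : exists l, k = 2 * l \/ k = 2 * l + 1.
  - by exists (k %/ 2)%Z; lia.
  - by move=> ->; exists (l * (2 * l + 3)); ring.
  - by move=> ->; exists ((2 * l + 1) * (l + 2)); ring.
have -> : (r - 2) * (r + 10) = j * 32.
  have -> : (r - 2) * (r + 10) = 16 * (k * (k + 3)) by rewrite rE; ring.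
  by rewrite jE; ring.
have -> : (- r - 2) * (- r + 10) = (j - (2 * k + 1)) * 32.
  have -> : (- r - 2) * (- r + 10) = 16 * (k * (k + 3)) - 32 * (2 * k + 1).
    by rewrite rE; ring.
  by rewrite jE; ring.
by rewrite !mulzK // subrK.
Qed.

Theorem theorem7p13 (R : realType) (r g : int) (hr : r != 0) (hg : g != 0)
    (E : ellcurve) (hE : E = cm_curve hg) :
  (varpi R E r = varpi R E (- r) <-> (r != 2 %[mod 4])%Z) /\
  ((r != 2 %[mod 4])%Z -> varpi R E r = 0 /\ varpi R E (- r) = 0).
Proof.
have vanish : (r != 2 %[mod 4])%Z -> varpi R E r = 0 /\ varpi R E (- r) = 0.
  by move=> /negPf r_mod4; rewrite /varpi mod4_oppz r_mod4.
split=> //; split=> [|/vanish[-> ->] //].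
apply: contra_eqN => r_mod4.
rewrite /varpi mod4_oppz r_mod4 hE twist_cm_curve.
have [_ g1_odd] := sign_2part_oddpartE hg.
(* Both h2 and Omega depend on r only through divisibility, so only the sign can change. *)
have h2N : h2 R (- r) = h2 R r.
  by rewrite /h2; under eq_fun do under eq_bigl do rewrite mulrN rpredN.
have OmegaN : Omega2_2 R (odd_part g) (- r) = Omega2_2 R (odd_part g) r.
  by rewrite /Omega2_2; under eq_bigl do rewrite rpredN.
rewrite h2N OmegaN; have [k ->] := exponent_oppz (eqP r_mod4).
set x := ((- r - 2) * (- r + 10) %/ 32)%Z.
set d := (sign_exp g)%:Z; set l := (two_exp g)%:Z.
set t := ((odd_part g - 1) %/ 2)%N%:Z.
have -> : (-1 : R) ^ (x + (2 * k + 1) + d + l + t) = - (-1) ^ (x + d + l + t).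
  have -> : x + (2 * k + 1) + d + l + t = x + d + l + t + 2 * k + 1 by ring.
  have N1_neq0 : -1 != 0 :> R by rewrite oppr_eq0 oner_eq0.
  have sq1 : (-1 : R) ^ (2 : int) = 1.
    by rewrite -[LHS]/((-1) ^+ 2) sqrrN expr1n.
  by rewrite !expfzDr // -exprz_exp sq1 exp1rz mulr1 expr1z mulrN1.
set s := (-1) ^ _.
have s_neq0 : s != 0 by rewrite expfz_neq0 // oppr_eq0 oner_eq0.
have J_neq0 : (jacobi 2 (odd_part g))%:~R != 0 :> R.
  by rewrite intr_eq0 jacobi2_neq0.
have O_neq0 := Omega2_2_neq0 R r g1_odd.
rewrite -subr_eq0.
set J := _%:~R in J_neq0 *; set O := Omega2_2 _ _ _ in O_neq0 *.
(* The constant terms cancel and leave a product of nonzero factors. *)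
have -> : h2 R r / 2 * (1 + 1 / 2 * - s * J * O)
    - h2 R r / 2 * (1 + 1 / 2 * s * J * O) = - 2^-1 * h2 R r * (s * J * O).
  by field.
apply: mulf_neq0; last by rewrite !mulf_neq0.
by rewrite mulf_neq0 ?oppr_eq0 ?invr_eq0 ?h2_neq0.
Qed.
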